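(* Let ${\bf a},{\bf b}\in(2\mathbb N)^p$ and ${\bf c}=(c_1,\ldots,c_q)\in(2\mathbb N)^q$, and let $n\ge\max(2,p+q)$ be an integer. Then $$\Phi_n\begin{pmatrix}{\bf a}&{\bf c}\\ {\bf b}&0\end{pmatrix}=\Phi_n\begin{pmatrix}{\bf a}&\Sigma c_i\\ {\bf b}&0\end{pmatrix},$$ where on the left the second row ends with $q$ zeros and on the right the matrix has $p+1$ columns, the last being $(\sum_i c_i,0)^T$.
   Context: Double factorial convention: for an integer $m\ge0$, $m!!=(m-1)(m-3)\cdots$, the product of the positive integers $\le m-1$ of the parity of $m-1$ (empty product $=1$). For a $2\times q$ matrix with nonnegative integer entries and $n\ge\max(2,q)$, $I_n\begin{pmatrix}{\bf a}\\{\bf b}\end{pmatrix}=\int_{O_n}\prod_j u_{1j}^{a_j}u_{2j}^{b_j}\,du$ (Haar probability measure) and $\Phi_n\begin{pmatrix}{\bf a}\\ {\bf b}\end{pmatrix}=\frac{(\Sigma a_i+n-2)!!\,(\Sigma b_i+n-2)!!}{(n-2)!!^2\,\prod a_i!!\,\prod b_i!!}\,I_n\begin{pmatrix}{\bf a}\\ {\bf b}\end{pmatrix}$. *)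

(* Defs.v *)
From HB Require Import structures.
From mathcomp Require Import all_boot all_order all_algebra.
From mathcomp Require Import all_classical all_reals all_analysis.
Set Implicit Arguments. Unset Strict Implicit. Unset Printing Implicit Defensive.
Import Order.TTheory GRing.Theory Num.Theory.
Local Open Scope ring_scope.
Local Open Scope classical_set_scope.

Fixpoint dfac (k : nat) : nat :=
  match k with 0 => 1 | 1 => 1 | k'.+2 => k'.+2 * dfac k' end%N.

(* the paper's convention: m!! := (m-1)(m-3)..., empty product = 1 (m = 0,1) *)
Definition pdf (m : nat) : nat := dfac m.-1.

Definition mxe (R : ringType) (n : nat) (A : 'M[R]_n) (i j : nat) : R :=
  odflt 0 (omap (fun k : 'I_n => odflt 0 (omap (A k) (insub j))) (insub i)).

Definition orthogonal_mx (R : ringType) (n : nat) (A : 'M[R]_n) : Prop :=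
  A *m A^T = 1%:M.

(* U is a Haar-distributed random orthogonal matrix on the probability space
   (T, P): it takes values in O_n, its entries are measurable, and its law
   (the joint law of its n^2 entries, determined by product rectangles) is
   invariant under left multiplication by any orthogonal matrix. *)
Definition haar_orthogonal (R : realType) (d : measure_display)
  (T : measurableType d) (P : probability T R) (n : nat)
  (U : T -> 'M[R]_n) : Prop :=
  [/\ (forall t, orthogonal_mx (U t)),
      (forall i j : 'I_n, measurable_fun setT (fun t => U t i j)) &
      (forall V : 'M[R]_n, orthogonal_mx V ->
        forall B : 'I_n -> 'I_n -> set R, (forall i j, measurable (B i j)) ->
        P [set t | forall i j, B i j (U t i j)] =
        P [set t | forall i j, B i j ((V *m U t) i j)])].

(* I_n (a over b) = E[ prod_j u_{1j}^{a_j} u_{2j}^{b_j} ] (rows 1,2 are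
   0-based rows 0,1; exponents beyond the length of the rows are 0) *)
Definition Imom (R : realType) (d : measure_display)
  (T : measurableType d) (P : probability T R) (n : nat)
  (U : T -> 'M[R]_n) (a b : seq nat) : \bar R :=
  (\int[P]_t (\prod_(j < n)
      (mxe (U t) 0 j ^+ nth 0%N a j * mxe (U t) 1 j ^+ nth 0%N b j))%:E)%E.

Definition Phi (R : realType) (d : measure_display)
  (T : measurableType d) (P : probability T R) (n : nat)
  (U : T -> 'M[R]_n) (a b : seq nat) : \bar R :=
  (((pdf (sumn a + n - 2) * pdf (sumn b + n - 2))%:R /
    ((pdf (n - 2) ^ 2 * \prod_(x <- a) pdf x * \prod_(x <- b) pdf x)%N)%:R)%:E
   * Imom P U a b)%E.

(* Main.v *)
Require Import Defs.
From HB Require Import structures.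
From mathcomp Require Import all_boot all_order all_algebra.
From mathcomp Require Import all_classical all_reals all_analysis.
From mathcomp Require Import measurable_realfun.
From mathcomp Require Import zify ring.

(** A left-invariant law on the orthogonal group is also right-invariant.
    Acting on columns [i] and [k] of [U] by the reflection sending [e_i] to
    [(s e_i + e_k) / sqrt (1 + s^2)] then gives, for every weight [X] that does
    not involve these columns and all [s],
    [\sum_j 'C(2m, j) s^j E[X u_i^j u_k^(2m-j)] = (1 + s^2)^m E[X u_i^(2m)]].
    Comparing the coefficients of [s^(2a)] with [m = a + b] merges the
    exponents [2a], [2b] of two columns into the single exponent [2a + 2b] at
    the cost of a ratio of double factorials; the theorem follows by merging
    the entries of [c] one at a time. *)

Set Implicit Arguments. Unset Strict Implicit. Unset Printing Implicit Defensive.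
Import Order.TTheory GRing.Theory Num.Theory.
Import numFieldNormedType.Exports.
Local Open Scope ring_scope.
Local Open Scope classical_set_scope.

(** * The sigma-algebra on matrices generated by their entries *)

Definition entry_rect (R : realType) (n : nat) : set (set 'M[R]_n) :=
  [set S | exists2 B : 'I_n -> 'I_n -> set R,
     (forall i j, measurable (B i j)) &
     S = [set A : 'M[R]_n | forall i j, B i j (A i j)]].

Arguments entry_rect : clear implicits.

(** The generators are exactly the events on which [haar_orthogonal] asserts invariance. They form a
    pi-system, so agreement on them determines a law on this measurable space. *)
Notation entries R n := (g_sigma_algebraType (entry_rect R n)).

Section entries.
Context {R : realType} {n : nat}.

Lemma setI_closed_entry_rect : setI_closed (entry_rect R n).
Proof.
move=> _ _ [B mB ->] [C mC ->]; exists (fun i j => B i j `&` C i j).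
  by move=> i j; exact: measurableI.
apply/seteqP; split=> [A [AB AC] i j|A ABC]; first by split.
by split=> i j; have [] := ABC i j.
Qed.

Lemma entry_rectT : entry_rect R n setT.
Proof. by exists (fun _ _ => setT) => //; apply/seteqP; split. Qed.

Lemma measurable_entry (i j : 'I_n) :
  measurable_fun [set: entries R n] (fun A : entries R n => (A : 'M[R]_n) i j).
Proof.
move=> _ Y mY; rewrite setTI; apply: sub_sigma_algebra.
exists (fun k l => if (k == i) && (l == j) then Y else setT).
  by move=> k l; case: ifP.
apply/seteqP; split=> [A YA k l|A /(_ i j)]; last by rewrite !eqxx.
by case: ifP => // /andP[/eqP -> /eqP ->].
Qed.

Lemma measurable_to_entries d (T : measurableType d) (X : T -> entries R n) :
  (forall i j, measurable_fun setT (fun t => (X t : 'M[R]_n) i j)) ->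
  measurable_fun setT X.
Proof.
move=> mX; apply: (@measurability _ _ _ _ _ X (entry_rect R n)) => //.
move=> _ [_ [B mB ->] <-]; rewrite setTI.
rewrite (_ : _ @^-1` _ = \bigcap_(ij in [set: 'I_n * 'I_n])
    ((fun t => (X t : 'M[R]_n) ij.1 ij.2) @^-1` B ij.1 ij.2)); last first.
  by apply/seteqP; split=> [t BX [i j] _|t BX i j]; [exact: BX|exact: (BX (i, j))].
apply: fin_bigcap_measurable => // -[i j] _.
by rewrite -[X in measurable X]setTI; exact: mX.
Qed.

Lemma measurable_mulmx d' (T' : measurableType d') (X Y : T' -> 'M[R]_n) :
  (forall i j, measurable_fun setT (fun t => X t i j)) ->
  (forall i j, measurable_fun setT (fun t => Y t i j)) ->
  measurable_fun setT (fun t => X t *m Y t : entries R n).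
Proof.
move=> mX mY; apply: measurable_to_entries => i j.
under eq_fun do rewrite mxE.
by apply: measurable_sum => k; exact: measurable_funM.
Qed.

Lemma measurable_trmx : measurable_fun [set: entries R n]
  (fun A : entries R n => (A : 'M[R]_n)^T : entries R n).
Proof.
apply: measurable_to_entries => i j.
by under eq_fun do rewrite mxE; exact: measurable_entry.
Qed.

(** The two pushforwards of [P] are finite measures agreeing on a generating pi-system that contains
    [setT], hence equal. A signed [f] is handled through its positive and negative parts. *)
Lemma eq_law_integral d (T : measurableType d) (P : probability T R)
    (X Y : T -> entries R n) (f : entries R n -> \bar R) :
  measurable_fun setT X -> measurable_fun setT Y ->
  measurable_fun [set: entries R n] f ->
  (forall S, entry_rect R n S -> P (X @^-1` S) = P (Y @^-1` S)) ->
  (\int[P]_t f (X t) = \int[P]_t f (Y t))%E.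
Proof.
move=> mX mY mf eqXY.
have ge0 (g : entries R n -> \bar R) : measurable_fun [set: entries R n] g ->
    (forall A, 0 <= g A)%E -> (\int[P]_t g (X t) = \int[P]_t g (Y t))%E.
  move=> mg g0.
  rewrite -[LHS](@ge0_integral_pushforward _ _ _ _ _ X mX P setT g)//.
  rewrite -[RHS](@ge0_integral_pushforward _ _ _ _ _ Y mY P setT g)//.
  apply: eq_measure_integral => A mA _.
  refine (@measure_unique _ R (entries R n) (entry_rect R n) (fun=> setT) erefl
    setI_closed_entry_rect _ _ _ _ _ _ A mA).
  - by move=> _; exact: entry_rectT.
  - by rewrite bigcup_const.
  - exact: eqXY.
  - by move=> _; rewrite /= /pushforward preimage_setT probability_setT ltry.
rewrite [LHS]integralE [RHS]integralE; congr (_ - _)%E.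
  rewrite (funepos_comp f X) (funepos_comp f Y).
  by apply: (ge0 (f^\+)%E) => //; exact: measurable_funepos.
rewrite (funeneg_comp f X) (funeneg_comp f Y).
by apply: (ge0 (f^\-)%E) => //; exact: measurable_funeneg.
Qed.

End entries.

(** * Invariance of the Haar law: left, transpose, right *)

Lemma orthogonal_mxT (R : comUnitRingType) (n : nat) (V : 'M[R]_n) :
  orthogonal_mx V -> orthogonal_mx V^T.
Proof. by rewrite /orthogonal_mx trmxK; exact: mulmx1C. Qed.

Section haar.
Context {R : realType} {d : measure_display} {T : measurableType d}.
Context {P : probability T R} {n : nat} {U : T -> 'M[R]_n}.
Hypothesis haarU : haar_orthogonal P U.

Lemma haar_orthogonalP t : orthogonal_mx (U t).
Proof. by have [] := haarU. Qed.

Lemma measurable_haar_entry i j : measurable_fun setT (fun t => U t i j).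
Proof. by have [] := haarU. Qed.

Lemma measurable_haar : measurable_fun setT (U : T -> entries R n).
Proof. exact/measurable_to_entries/measurable_haar_entry. Qed.

Lemma haar_left_invariant (V : 'M[R]_n) (f : entries R n -> \bar R) :
  orthogonal_mx V -> measurable_fun [set: entries R n] f ->
  (\int[P]_t f (V *m U t) = \int[P]_t f (U t))%E.
Proof.
move=> oV mf; apply: (@eq_law_integral _ _ _ _ _ (fun t => V *m U t) U) => //.
- by apply: measurable_mulmx => // i j; exact: measurable_haar_entry.
- exact: measurable_haar.
- move=> _ [B mB ->]; have [_ _ inv] := haarU.
  by rewrite -[LHS]/(P [set t | forall i j, B i j ((V *m U t) i j)]) -inv.
Qed.

(* Averaging over [s] and [t] in [f (U_s^T *m U_t)] gives the law of [U] by
   left invariance in [t], and the law of [U^T] by left invariance in [s]. *)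
Lemma haar_trmx (f : entries R n -> \bar R) :
  measurable_fun [set: entries R n] f ->
  (\int[P]_t f (U t)^T = \int[P]_t f (U t))%E.
Proof.
move=> mf.
have mUT : measurable_fun setT (fun t => (U t)^T : entries R n).
  apply: measurable_to_entries => i j.
  by under eq_fun do rewrite mxE; exact: measurable_haar_entry.
apply: (@eq_law_integral _ _ _ _ _ (fun t => (U t)^T) U) => //.
  exact: measurable_haar.
move=> S GS; have mS : measurable (S : set (entries R n)).
  exact: sub_sigma_algebra.
(* Laws are compared on one rectangle through its indicator, which is nonnegative, so Tonelli
   applies without an integrability condition. *)
pose g (A : entries R n) : \bar R := (\1_S A)%:E.
have mg : measurable_fun [set: entries R n] g by exact/measurable_EFinP.
have Pg (X : T -> entries R n) : measurable_fun setT X ->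
    P (X @^-1` S) = (\int[P]_t g (X t))%E.
  move=> mX; rewrite (_ : (\int[P]_t g (X t))%E =
    (\int[P]_t (\1_(X @^-1` S) t)%:E)%E)// integral_indic ?setIT//.
  by rewrite -[X in measurable X]setTI; exact: mX.
rewrite !Pg//; last exact: measurable_haar.
pose h (st : T * T) := g ((U st.1)^T *m U st.2).
have mh : measurable_fun setT h.
  apply: (@measurableT_comp _ _ _ _ _ _ g) => //.
  apply: measurable_mulmx => i j.
    under eq_fun do rewrite mxE.
    exact: (measurableT_comp (measurable_haar_entry _ _)).
  exact: (measurableT_comp (measurable_haar_entry _ _)).
have h0 st : (0 <= h st)%E by rewrite lee_fin indicE.
have prob1 (r : \bar R) : (\int[P]_(x in setT) r = r)%E.
  by rewrite integral_cst//= -[RHS]mule1 -(@probability_setT _ _ _ P).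
have := @fubini_tonelli _ _ _ _ _ P P h mh h0.
rewrite /h /=; under eq_integral => s _.
  rewrite haar_left_invariant//; last exact/orthogonal_mxT/haar_orthogonalP.
  over.
rewrite prob1.
under [in RHS]eq_integral => t _.
  (* Writing the product as [((U t)^T *m U s)^T] leaves a fixed orthogonal factor on the left of
     [U s], so left invariance applies to [g] composed with transposition. *)
  under eq_integral => s _ do rewrite -[U t]trmxK -trmx_mul.
  rewrite (@haar_left_invariant _ (fun A => g (A : 'M[R]_n)^T)); last 2 first.
  - exact/orthogonal_mxT/haar_orthogonalP.
  - exact: (measurableT_comp mg measurable_trmx).
  over.
by rewrite prob1 => ->.
Qed.

(** Transposition turns right multiplication by [W] into left multiplication by [W^T], and preserves
    the law by [haar_trmx]. *)
Lemma haar_right_invariant (W : 'M[R]_n) (f : entries R n -> \bar R) :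
  orthogonal_mx W -> measurable_fun [set: entries R n] f ->
  (\int[P]_t f (U t *m W) = \int[P]_t f (U t))%E.
Proof.
move=> oW mf.
have mW : measurable_fun [set: entries R n]
    (fun A : entries R n => (A : 'M[R]_n) *m W : entries R n).
  by apply: measurable_mulmx => i j //; exact: measurable_entry.
transitivity (\int[P]_t f ((U t)^T *m W))%E.
  by rewrite -(haar_trmx (measurableT_comp mf mW)).
transitivity (\int[P]_t f ((W^T *m U t)^T))%E.
  by apply: eq_integral => t _; rewrite trmx_mul trmxK.
rewrite (@haar_left_invariant _ (fun A => f (A : 'M[R]_n)^T)).
- exact: haar_trmx.
- exact: orthogonal_mxT.
- exact: (measurableT_comp mf measurable_trmx).
Qed.

End haar.

(** * Reflections, and an identity principle for polynomials *)

Lemma householder_orthogonal (R : fieldType) (n : nat) (v : 'rV[R]_n) (k : R) :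
  k * (v *m v^T) 0 0 = 2 -> orthogonal_mx (1%:M - k *: (v^T *m v)).
Proof.
move=> kv; rewrite /orthogonal_mx.
have -> : (1%:M - k *: (v^T *m v))^T = 1%:M - k *: (v^T *m v).
  by rewrite linearB linearZ /= trmx1 trmx_mul trmxK.
(* By symmetry the product is a square, [1 - 2k v^T v + k^2 |v|^2 v^T v], and [k |v|^2 = 2] cancels
   the last two terms. *)
rewrite mulmxBl mul1mx mulmxBr mulmx1 -scalemxAl -scalemxAr mulmxA.
rewrite -(mulmxA v^T v v^T) (mx11_scalar (v *m v^T)) mul_mx_scalar.
rewrite -scalemxAl !scalerA kv mulr_natr -scalerMnl.
by rewrite mulr2n opprB addrK subrK.
Qed.

(** A nonzero difference would have as many distinct roots as its size, namely the first natural
    numbers, which are distinct in [R]. *)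
Lemma poly_eq_horner (R : numDomainType) (p q : {poly R}) :
  (forall x, p.[x] = q.[x]) -> p = q.
Proof.
move=> pq; apply/eqP; rewrite -subr_eq0; apply/negPn/negP => pq0.
pose rs := [seq (i%:R : R) | i <- iota 0 (size (p - q))].
suff /(max_poly_roots pq0) : all (root (p - q)) rs.
  rewrite size_map size_iota ltnn map_inj_uniq ?iota_uniq => [/(_ isT)//|].
  by move=> i j /eqP; rewrite eqr_nat => /eqP.
by apply/allP => x _; rewrite /root hornerD hornerN pq subrr.
Qed.

(** This is [|w - e|^2 = 2 (1 - <w, e>)] for the unit vectors [w = (c s, c)] and [e = (1, 0)]. *)
Lemma unit_vector_dist (R : comPzRingType) (c s : R) :
  c ^+ 2 * (1 + s ^+ 2) = 1 -> (c * s - 1) ^+ 2 + c ^+ 2 = 2 * (1 - c * s).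
Proof.
move=> cs1; transitivity (c ^+ 2 * (1 + s ^+ 2) + (1 - 2 * (c * s))).
  by ring.
by rewrite cs1; ring.
Qed.

(* [W] is the reflection exchanging [e_i] and the unit vector of direction
   [s *: e_i + e_k]. *)
Lemma reflection_to_unit_vector (R : rcfType) (n : nat) (i k : 'I_n) (s : R) :
  i != k ->
  exists2 W : 'M[R]_n, orthogonal_mx W & forall (A : 'M[R]_n) r,
    (A *m W) r i = (Num.sqrt (1 + s ^+ 2))^-1 * (s * A r i + A r k) /\
    forall j, j != i -> j != k -> (A *m W) r j = A r j.
Proof.
move=> ik; set c := (Num.sqrt _)^-1.
have s2 : 0 < 1 + s ^+ 2 by rewrite ltr_pwDl// sqr_ge0.
have c0 : c != 0 by rewrite invr_neq0// sqrtr_eq0 -ltNge.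
have c2 : c ^+ 2 * (1 + s ^+ 2) = 1.
  by rewrite exprVn sqr_sqrtr ?mulVf ?gt_eqF// ltW.
clearbody c; pose e j : 'rV[R]_n := delta_mx 0 j.
(* The normal of the reflection: the unit vector [c *: (s *: e i + e k)] minus [e i]. *)
pose v := (c * s - 1) *: e i + c *: e k.
have Ae (A : 'M[R]_n) r j : (A *m (e j)^T) r 0 = A r j.
  rewrite mxE (bigD1 j)//= !mxE !eqxx mulr1 big1 ?addr0// => l lj.
  by rewrite !mxE (negPf lj) mulr0.
have vE j : v 0 j = (c * s - 1) * (j == i)%:R + c * (j == k)%:R.
  by rewrite !mxE.
have Av (A : 'M[R]_n) r :
    (A *m v^T) r 0 = (c * s - 1) * A r i + c * A r k.
  rewrite linearD !linearZ /= mulmxDr -!scalemxAr mxE mxE Ae.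
  by rewrite [X in _ + X]mxE Ae.
have vv : (v *m v^T) 0 0 = 2 * (1 - c * s).
  rewrite mxE (bigD1 i)//= (bigD1 k) 1?eq_sym//= big1 ?addr0.
    rewrite [v^T i _]mxE [v^T k _]mxE !vE !eqxx [k == i]eq_sym (negPf ik) /=.
    rewrite !(mulr0, mulr1, addr0, add0r) -!expr2.
    exact: unit_vector_dist.
  by move=> j /andP[ji jk]; rewrite vE (negPf ji) (negPf jk) !mulr0 addr0 mul0r.
(* If [c * s = 1], then [c2] reads [c^2 + 1 = 1], contradicting [c0]. *)
have cs : 1 - c * s != 0.
  rewrite subr_eq0 eq_sym; apply: contraNneq c0 => cs.
  by move/eqP: c2; rewrite mulrDr mulr1 -exprMn cs expr1n -subr_eq0 addrK sqrf_eq0.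
(* The coefficient is [2 / |v|^2], computed from [vv]. *)
exists (1%:M - (1 - c * s)^-1 *: (v^T *m v)).
  by apply: householder_orthogonal; rewrite vv mulrCA mulVf// mulr1.
move=> A r; rewrite mulmxBr mulmx1 -scalemxAr mulmxA.
have AW j : (A - (1 - c * s)^-1 *: (A *m v^T *m v)) r j =
    A r j - (1 - c * s)^-1 * (((c * s - 1) * A r i + c * A r k) * v 0 j).
  by rewrite mxE [X in _ + X]mxE [X in _ - X]mxE [X in _ * X]mxE big_ord1 Av.
split=> [|j ji jk]; rewrite AW vE.
  by rewrite eqxx (negPf ik) mulr1 mulr0 addr0; field.
by rewrite (negPf ji) (negPf jk) !mulr0 addr0 !mulr0 subr0.
Qed.

(** * Double factorials and binomial coefficients *)

Lemma dfac_fact (m : nat) : (dfac m.+1 * dfac m = (m.+1)`!)%N.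
Proof.
elim: m => // m IHm; rewrite factS -IHm -[dfac m.+2]/(m.+2 * dfac m)%N.
by rewrite -mulnA [(dfac m * _)%N]mulnC.
Qed.

Lemma dfac_double (m : nat) : (dfac m.*2 = 2 ^ m * m`!)%N.
Proof.
elim: m => // m IHm; rewrite doubleS -[dfac _]/(m.*2.+2 * dfac m.*2)%N IHm.
by rewrite expnS factS -muln2; lia.
Qed.

(** The factors of [(m.*2)!] split into the odd ones, [pdf m.*2], and the even ones,
    [2 ^ m * m!]. *)
Lemma pdf_double_fact (m : nat) : (pdf m.*2 * (2 ^ m * m`!) = (m.*2)`!)%N.
Proof.
case: m => // m; rewrite -dfac_double doubleS -dfac_fact mulnC /pdf.
by congr (_ * _)%N.
Qed.

Lemma pdf_gt0 m : (0 < pdf m)%N.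
Proof.
rewrite /pdf; have [k] := ubnP m.-1; elim: k m.-1 => // k IHk [|[|l]] //= lk.
by rewrite muln_gt0 /= IHk// ltnW.
Qed.

(** After multiplication by [2 ^ a * a!] and [2 ^ b * b!], both sides become [((a + b).*2)!]. *)
Lemma bin_pdf a b :
  ('C((a + b).*2, a.*2) * (pdf a.*2 * pdf b.*2) = 'C(a + b, a) * pdf (a + b).*2)%N.
Proof.
have pos c : (0 < 2 ^ c * c`!)%N by rewrite muln_gt0 expn_gt0 fact_gt0.
apply/eqP; rewrite -(eqn_pmul2r (pos a)) -(eqn_pmul2r (pos b)); apply/eqP.
transitivity ((a + b).*2)`!.
  have ab2 : (a.*2 <= (a + b).*2)%N by lia.
  rewrite -(bin_fact ab2) (_ : (a + b).*2 - a.*2 = b.*2)%N; last lia.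
  by rewrite -!pdf_double_fact; lia.
have ab : (a <= a + b)%N by lia.
rewrite -pdf_double_fact -(bin_fact ab) addKn expnD; lia.
Qed.

(** * Monomials in two rows: boundedness and integrability *)

Lemma orthogonal_entry_le1 (R : realDomainType) (n : nat) (A : 'M[R]_n) i j :
  orthogonal_mx A -> `|A i j| <= 1.
Proof.
move=> /matrixP/(_ i i); rewrite [LHS]mxE [RHS]mxE eqxx mulr1n => A1.
have sq k : 0 <= A i k * A^T k i by rewrite mxE -expr2 sqr_ge0.
have : A i j ^+ 2 <= 1.
  by rewrite -A1 (bigD1 j)//= [A^T j i]mxE -expr2 lerDl sumr_ge0.
by rewrite -real_normK ?num_real// expr_le1.
Qed.

(** The integrand of [Imom], with ordinals for the two rows instead of the default-valued accessor
    [mxe]. *)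
Definition mono (R : pzRingType) (n : nat) (r0 r1 : 'I_n)
    (al be : 'I_n -> nat) (A : 'M[R]_n) : R :=
  \prod_(j < n) (A r0 j ^+ al j * A r1 j ^+ be j).

Lemma mono_le1 (R : realDomainType) (n : nat) (r0 r1 : 'I_n) al be
  (A : 'M[R]_n) : orthogonal_mx A -> `|mono r0 r1 al be A| <= 1.
Proof.
move=> oA; rewrite normr_prod; apply: Num.Theory.prodr_ile1 => j _.
rewrite normr_ge0 normrM !normrX mulr_ile1 ?exprn_ge0//.
  by rewrite exprn_ile1 ?orthogonal_entry_le1.
by rewrite exprn_ile1 ?orthogonal_entry_le1.
Qed.

Section moments.
Context {R : realType} {d : measure_display} {T : measurableType d}.
Context {P : probability T R} {n : nat} {U : T -> 'M[R]_n}.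
Hypothesis haarU : haar_orthogonal P U.

Lemma measurable_mono (r0 r1 : 'I_n) (al be : 'I_n -> nat) :
  measurable_fun [set: entries R n] (mono r0 r1 al be : entries R n -> R).
Proof.
apply: measurable_prod => j _.
by apply: measurable_funM; apply: measurable_funX; exact: measurable_entry.
Qed.

Lemma integrable_haar (f : entries R n -> R) :
  measurable_fun [set: entries R n] f ->
  (forall A : 'M[R]_n, orthogonal_mx A -> `|f A| <= 1) ->
  P.-integrable setT (fun t => (f (U t))%:E).
Proof.
move=> mf f1; apply: (@measurable_bounded_integrable _ _ _ P (f \o U)) => //.
- by rewrite (le_lt_trans (probability_le1 P measurableT))// ltry.
- exact: (measurableT_comp mf (measurable_haar haarU)).
- exists 1; split => // x x1 t _ /=.
  by rewrite (le_trans (f1 _ _) (ltW x1))//; exact: (haar_orthogonalP haarU).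
Qed.

(** * Merging the exponents of two columns *)

Section two_columns.
Variables (i k r0 r1 : 'I_n) (al be : 'I_n -> nat).
Hypotheses (ik : i != k).
Hypotheses (ali : al i = 0%N) (alk : al k = 0%N).
Hypotheses (bei : be i = 0%N) (bek : be k = 0%N).

(** Since [al] and [be] vanish at [i] and [k], the first factor is a weight free of these columns,
    and the second carries all dependence on them. *)
Definition mono2 (p q : nat) (A : 'M[R]_n) : R :=
  mono r0 r1 al be A * (A r0 i ^+ p * A r0 k ^+ q).

Definition moment2 (p q : nat) : R := (\int[P]_t mono2 p q (U t))%R.

Lemma measurable_mono2 p q :
  measurable_fun [set: entries R n] (mono2 p q : entries R n -> R).
Proof.
apply: measurable_funM; first exact: measurable_mono.
by apply: measurable_funM; apply: measurable_funX; exact: measurable_entry.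
Qed.

Lemma integrable_mono2 p q :
  P.-integrable setT (fun t => (mono2 p q (U t))%:E).
Proof.
apply: (integrable_haar (measurable_mono2 p q)) => A oA.
rewrite normrM mulr_ile1 ?mono_le1// normrM !normrX mulr_ile1 ?exprn_ge0//.
  by rewrite exprn_ile1 ?orthogonal_entry_le1.
by rewrite exprn_ile1 ?orthogonal_entry_le1.
Qed.

Lemma moment2E p q : (\int[P]_t (mono2 p q (U t))%:E = (moment2 p q)%:E)%E.
Proof. by rewrite fineK//; exact: integrable_fin_num (integrable_mono2 p q). Qed.

Lemma eq_mono (A B : 'M[R]_n) :
  (forall r j, j != i -> j != k -> A r j = B r j) ->
  mono r0 r1 al be A = mono r0 r1 al be B.
Proof.
move=> AB; apply: eq_bigr => j _.
have [->|ji] := eqVneq j i; first by rewrite ali bei !expr0.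
have [->|jk] := eqVneq j k; first by rewrite alk bek !expr0.
by rewrite !AB.
Qed.

(** Right invariance replaces [U] by [U *m W], which fixes the weight and turns column [i] into a
    multiple of [s u_i + u_k]. The binomial theorem expands its power. *)
Lemma moment2_reflect m s :
  \sum_(j < m.*2.+1) 'C(m.*2, j)%:R * s ^+ j * moment2 j (m.*2 - j) =
  (1 + s ^+ 2) ^+ m * moment2 m.*2 0.
Proof.
have [W oW AW] := @reflection_to_unit_vector R n i k s ik.
have s2 : 0 < 1 + s ^+ 2 by rewrite ltr_pwDl// sqr_ge0.
pose c := (1 + s ^+ 2)^-1 ^+ m.
pose co j := c * ('C(m.*2, j)%:R * s ^+ j).
have rotE t : mono2 m.*2 0 (U t *m W) =
    \sum_(j < m.*2.+1) co j * mono2 j (m.*2 - j) (U t).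
  have [r0W _] := AW (U t) r0.
  rewrite /mono2 (@eq_mono (U t *m W) (U t)); last first.
    by move=> r j ji jk; have [_ ->] := AW (U t) r.
  (* The even degree removes the square root, so that the identity becomes polynomial in [s]. *)
  have sqc : (Num.sqrt (1 + s ^+ 2))^-1 ^+ m.*2 = c.
    by rewrite -mul2n exprM exprVn sqr_sqrtr// ltW.
  rewrite expr0 mulr1 r0W exprMn sqc mulrCA addrC exprDn !mulr_sumr.
  by apply: eq_bigr => j _; rewrite /co exprMn -mulr_natr; ring.
have : moment2 m.*2 0 = \sum_(j < m.*2.+1) co j * moment2 j (m.*2 - j).
  have mf : measurable_fun [set: entries R n]
      (fun A : entries R n => (mono2 m.*2 0 A)%:E).
    by apply/measurable_EFinP; exact: measurable_mono2.
  apply: EFin_inj; rewrite -moment2E -(haar_right_invariant haarU oW mf).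
  under eq_integral => t _ do rewrite rotE -sumEFin.
  rewrite integral_sum//; last first.
    move=> j; under eq_fun do rewrite EFinM.
    by apply: integrableZl => //; exact: integrable_mono2.
  rewrite -sumEFin; apply: eq_bigr => j _.
  under eq_integral => t _ do rewrite EFinM.
  rewrite integralZl//; last exact: integrable_mono2.
  by rewrite moment2E.
move=> ->; rewrite mulr_sumr; apply: eq_bigr => j _.
by rewrite /co /c !mulrA exprVn divff ?mul1r// expf_neq0// gt_eqF.
Qed.

Lemma bin_moment2 a b :
  'C((a + b).*2, a.*2)%:R * moment2 a.*2 b.*2 =
  'C(a + b, a)%:R * moment2 (a + b).*2 0.
Proof.
pose m := (a + b)%N.
pose p : {poly R} := \poly_(j < m.*2.+1) ('C(m.*2, j)%:R * moment2 j (m.*2 - j)).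
(* Composing [(1 + X)^m] with ['X^2] makes the coefficient at [a.*2] directly the binomial
   ['C(m, a)]. *)
pose q : {poly R} :=
  moment2 m.*2 0 *: ((\poly_(j < m.+1) 'C(m, j)%:R) \Po 'X^2).
have pq : p = q.
  apply: poly_eq_horner => s.
  rewrite horner_poly hornerZ horner_comp horner_poly hornerXn mulrC.
  have -> : \sum_(j < m.+1) 'C(m, j)%:R * s ^+ 2 ^+ j = (1 + s ^+ 2) ^+ m.
    rewrite exprDn; apply: eq_bigr => j _.
    by rewrite expr1n mul1r mulr_natl.
  by rewrite -moment2_reflect; apply: eq_bigr => j _; rewrite mulrAC.
have := congr1 (fun r : {poly R} => r`_(a.*2)) pq.
rewrite coefZ coef_comp_poly_Xn// -{2 3}muln2 dvdn_mull// mulnK// !coef_poly.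
rewrite !ltnS leq_double leq_addr -doubleB addKn => ->.
by rewrite mulrC.
Qed.

(** [bin_pdf] trades the two binomials of [bin_moment2] for double factorials. *)
Lemma merge_moment2 a b :
  (pdf (a + b).*2)%:R * moment2 a.*2 b.*2 =
  (pdf a.*2 * pdf b.*2)%:R * moment2 (a + b).*2 0.
Proof.
have C0 : 'C((a + b).*2, a.*2)%:R != 0 :> R.
  by rewrite pnatr_eq0 -lt0n bin_gt0 leq_double leq_addr.
apply: (mulfI C0); rewrite mulrCA bin_moment2 !mulrA -!natrM bin_pdf.
by rewrite [(pdf _ * _)%N]mulnC.
Qed.

End two_columns.
End moments.

(** * Moments indexed by sequences of exponents *)

Section row_moments.
Context {R : realType} {d : measure_display} {T : measurableType d}.
Context {P : probability T R} {n : nat} {U : T -> 'M[R]_n}.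
Hypotheses (haarU : haar_orthogonal P U) (n2 : (1 < n)%N).
Implicit Types a b c : seq nat.

Lemma eq_Imom a b a' b' :
  nth 0%N a =1 nth 0%N a' -> nth 0%N b =1 nth 0%N b' ->
  Imom P U a b = Imom P U a' b'.
Proof.
move=> aa' bb'; apply: eq_integral => t _; congr EFin.
by apply: eq_bigr => j _; rewrite aa' bb'.
Qed.

Let row0 : 'I_n := Ordinal (ltnW n2).
Let row1 : 'I_n := Ordinal n2.

Lemma ImomE a b : Imom P U a b =
  (\int[P]_t (mono row0 row1 (nth 0%N a) (nth 0%N b) (U t))%:E)%E.
Proof.
apply: eq_integral => t _; congr EFin; apply: eq_bigr => j _.
have mxeE (r : 'I_n) : mxe (U t) r j = U t r j by rewrite /mxe !(valK (_ : 'I_n)).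
by rewrite -(mxeE row0) -(mxeE row1).
Qed.

(** The moments are finite ([rImomK]), so the algebra can be done in the field [R] rather than in
    [\bar R]. *)
Definition rImom a b : R := fine (Imom P U a b).

Lemma rImomK a b : (rImom a b)%:E = Imom P U a b.
Proof.
rewrite fineK// ImomE; apply: integrable_fin_num => //.
apply: (integrable_haar haarU (measurable_mono _ _ _ _)) => A.
exact: mono_le1.
Qed.

Lemma rImom_cat2 a b x y (i k : 'I_n) :
  i = size a :> nat -> k = (size a).+1 :> nat ->
  rImom (a ++ [:: x; y]) b =
  @moment2 R d T P n U i k row0 row1 (nth 0%N a) (nth 0%N b) x y.
Proof.
move=> ia ka; rewrite /rImom ImomE; congr fine.
apply: eq_integral => t _; congr EFin.
(* A power of one entry is spread over all columns with an indicator exponent, so that the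
   integrands can be compared column by column. *)
have pick (F : 'I_n -> R) (j0 : 'I_n) (e : nat) :
    F j0 ^+ e = \prod_(j < n) F j ^+ ((j == j0) * e).
  rewrite (bigD1 j0)//= eqxx mul1n big1 ?mulr1// => j /negPf ->.
  by rewrite mul0n expr0.
rewrite /mono2 (pick (U t row0) i) (pick (U t row0) k) -!big_split /=.
apply: eq_bigr => j _; rewrite mulrAC -!exprD; congr (_ ^+ _ * _).
rewrite nth_cat -!val_eqE /= ia ka.
have [ja|aj] := ltnP j (size a).
  by rewrite !ltn_eqF ?mul0n ?addn0// ltnW.
rewrite [nth 0%N a j]nth_default//.
have [->|] := eqVneq (j : nat) (size a).
  by rewrite subnn ltn_eqF //= mul0n mul1n addn0.
have [->|j1 j0] := eqVneq (j : nat) (size a).+1.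
  by rewrite subSnn mul1n.
rewrite nth_default//=; lia.
Qed.

Lemma merge_rImom a b x y :
  ((size a).+1 < n)%N -> (forall l, (size a <= l)%N -> nth 0%N b l = 0%N) ->
  ~~ odd x -> ~~ odd y ->
  (pdf (x + y))%:R * rImom (a ++ [:: x; y]) b =
  (pdf x * pdf y)%:R * rImom (a ++ [:: (x + y)%N]) b.
Proof.
move=> an b0 /even_halfK xE /even_halfK yE.
pose i : 'I_n := Ordinal (ltnW an); pose k : 'I_n := Ordinal an.
(* Padding with a zero exponent puts the merged row in the same two-column form as the original
   one. *)
have -> : rImom (a ++ [:: (x + y)%N]) b = rImom (a ++ [:: (x + y)%N; 0%N]) b.
  congr fine; apply: eq_Imom => // l; rewrite !nth_cat.
  by case: ltnP => // _; case: (l - _)%N => [|[|[|]]].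
rewrite !(@rImom_cat2 _ _ _ _ i k)//.
rewrite -xE -yE -doubleD; apply: merge_moment2 => //.
- by rewrite -val_eqE /= ltn_eqF.
- by rewrite nth_default.
- by rewrite nth_default.
- exact: b0.
- exact: b0.
Qed.

(** Induction from the right: the last two exponents [y], [x] are merged, and the induction
    hypothesis treats the shorter row ending in [y + x]. The auxiliary factor [pdf (y + x)] then
    cancels. The strict size bound provides the column of [x], which has index [size a + size c]. *)
Lemma merge_row_rImom a b c x :
  (size a + size c < n)%N -> (forall l, (size a <= l)%N -> nth 0%N b l = 0%N) ->
  all (fun y => ~~ odd y) c -> ~~ odd x ->
  (pdf (sumn c + x))%:R * rImom (a ++ rcons c x) b =
  (\prod_(y <- rcons c x) pdf y)%N%:R * rImom (a ++ [:: (sumn c + x)%N]) b.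
Proof.
elim/last_ind: c x => [|c y IHc] x; first by rewrite add0n big_seq1.
rewrite size_rcons all_rcons sumn_rcons => acn b0 /andP[ey ec] ex.
have pyx0 : (pdf (y + x))%:R != 0 :> R by rewrite pnatr_eq0 -lt0n pdf_gt0.
have /IHc : (size a + size c < n)%N by lia.
move=> /(_ (y + x)%N b0 ec); rewrite oddD (negPf ey) (negPf ex) => /(_ isT) IH.
have := @merge_rImom (a ++ c) b y x.
rewrite size_cat -!catA => /(_ _ _ ey ex) M; rewrite -cats1 -cats1 -catA /=.
apply: (mulfI pyx0); rewrite mulrCA M; last 2 first.
- lia.
- by move=> l /(leq_trans (leq_addr _ _)); exact: b0.
rewrite cats1 mulrCA -addnA IH !big_cat big_rcons /= !big_cons big_nil.
by rewrite !natrM; ring.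
Qed.

End row_moments.
Arguments rImom {R d T} P {n} U a b.

(** * From moments to the normalised quantity [Phi] *)

Lemma Phi_eq (R : realType) (d : measure_display) (T : measurableType d)
  (P : probability T R) (n : nat) (U : T -> 'M[R]_n) (a a' b b' : seq nat) :
  haar_orthogonal P U -> (1 < n)%N ->
  sumn a = sumn a' -> sumn b = sumn b' ->
  (\prod_(x <- b) pdf x = \prod_(x <- b') pdf x)%N ->
  (\prod_(x <- a') pdf x)%N%:R * rImom P U a b =
    (\prod_(x <- a) pdf x)%N%:R * rImom P U a' b' ->
  Phi P U a b = Phi P U a' b'.
Proof.
move=> haarU n2 aa bb pb eqI; rewrite /Phi -!(rImomK haarU n2) -!EFinM aa bb pb.
congr EFin.
have gt0 (s : seq nat) : (\prod_(x <- s) pdf x)%N%:R != 0 :> R.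
  by rewrite pnatr_eq0 -lt0n prodn_gt0// => x; exact: pdf_gt0.
have gt0' : (pdf (n - 2))%:R != 0 :> R by rewrite pnatr_eq0 -lt0n pdf_gt0.
(* The other normalising factors depend only on the sums and on the product over [b], which agree,
   so the cross-multiplied identity of moments suffices. *)
have -> : rImom P U a b = (\prod_(x <- a) pdf x)%N%:R *
    rImom P U a' b' / (\prod_(x <- a') pdf x)%N%:R.
  by rewrite -eqI mulrC mulKf.
by rewrite !natrM; field; rewrite gt0' !gt0.
Qed.

Theorem theorem3p4 (R : realType) (d : measure_display) (T : measurableType d)
  (P : probability T R) (n : nat) (U : T -> 'M[R]_n)
  (a b c : seq nat) :
  haar_orthogonal P U ->
  size b = size a ->
  all (fun x => ~~ odd x) a -> all (fun x => ~~ odd x) b ->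
  all (fun x => ~~ odd x) c ->
  (maxn 2 (size a + size c) <= n)%N ->
  Phi P U (a ++ c) (b ++ nseq (size c) 0%N) =
  Phi P U (rcons a (sumn c)) (rcons b 0%N).
Proof.
move=> haarU ba _ _ ec; rewrite geq_max => /andP[n2 acn].
(* Trailing zeros are invisible to [nth] with default [0], hence to [Imom]; they do not affect the
   normalisation either, as [pdf 0 = 1]. *)
have nth0 s m : nth 0%N (s ++ nseq m 0%N) =1 nth 0%N s.
  move=> l; rewrite nth_cat nth_nseq if_same.
  by case: ltnP => // sl; rewrite nth_default.
apply: Phi_eq => //.
- by rewrite sumn_cat sumn_rcons.
- by rewrite sumn_cat sumn_nseq sumn_rcons.
- by rewrite big_cat big_rcons /= big_nseq_cond /= iter_muln exp1n.
have eqb a' m : rImom P U a' (b ++ nseq m 0%N) = rImom P U a' b.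
  by rewrite /rImom; congr fine; apply: eq_Imom.
rewrite eqb -(cats1 b 0%N) (eqb _ 1%N).
rewrite big_cat big_rcons /= !natrM -!mulrA; congr (_ * _).
have b0 l : (size a <= l)%N -> nth 0%N b l = 0%N.
  by move=> al; rewrite nth_default// ba.
(* For empty [c] the right-hand row gains a zero exponent, possibly in a position past the last
   column of [U]; padding by zero covers this case. Otherwise the merging lemma applies. *)
case/lastP: c ec acn => [_ _|c x].
  rewrite big_nil /rImom; congr (_ * fine _); apply: eq_Imom => // l.
  by rewrite cats0 -cats1 (nth0 a 1%N).
rewrite all_rcons size_rcons sumn_rcons => /andP[ex ec] acn.
rewrite (merge_row_rImom haarU n2) ?cats1//; lia.
Qed.
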